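(* Let $m\ge n\ge 2$, and let $A\in\mathbb{R}^{m\times n}$ have simple singular values $\sigma_1>\cdots>\sigma_n>0$ with corresponding left singular vectors $u_1,\ldots,u_n$. Let $b\in\mathbb{R}^m$ satisfy $u_j^Tb\neq0$ for $j=1,\ldots,n$. Let $1\le k\le n-1$, let $P_{k+1},Q_k,B_k$ and $\alpha_{k+1}$ be the quantities produced by $k$ steps of Lanczos bidiagonalization of $A$ started with $p_1=b/\|b\|$, and put $\gamma_k=\|A-P_{k+1}B_kQ_k^T\|$. Then $$\alpha_{k+1}\le\gamma_k.$$
   Context: $\|\cdot\|$ is the Euclidean norm of a vector or the spectral norm of a matrix. All computations are in exact arithmetic. Lanczos bidiagonalization: starting from $p_1=b/\|b\|$ and $\alpha_1q_1=A^Tp_1$, for $i=1,2,\ldots$ compute $\beta_{i+1}p_{i+1}=Aq_i-\alpha_ip_i$ and $\alpha_{i+1}q_{i+1}=A^Tp_{i+1}-\beta_{i+1}q_i$, where $\alpha_i,\beta_i>0$ are chosen so that all $p_i\in\mathbb{R}^m$ and $q_i\in\mathbb{R}^n$ have unit norm. Under the stated assumptions no breakdown occurs for $k\le n-1$. The matrices $Q_k=(q_1,\ldots,q_k)$ and $P_{k+1}=(p_1,\ldots,p_{k+1})$ have orthonormal columns, and $B_k\in\mathbb{R}^{(k+1)\times k}$ is the lower bidiagonal matrix with diagonal entries $\alpha_1,\ldots,\alpha_k$ and subdiagonal entries $\beta_2,\ldots,\beta_{k+1}$. They satisfy $$AQ_k=P_{k+1}B_k,\qquad A^TP_{k+1}=Q_kB_k^T+\alpha_{k+1}q_{k+1}e_{k+1}^T,$$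 where $e_{k+1}$ is the last canonical basis vector of $\mathbb{R}^{k+1}$. *)

(* Defs.v *)
From HB Require Import structures.
From mathcomp Require Import all_boot all_order all_algebra.
From mathcomp Require Import boolp classical_sets reals.

Set Implicit Arguments.
Unset Strict Implicit.
Unset Printing Implicit Defensive.

Import Order.TTheory GRing.Theory Num.Theory.
Local Open Scope ring_scope.
Local Open Scope classical_set_scope.

(* MathComp-Analysis puts the max norm on matrices, so the Euclidean and
   spectral norms are defined here. *)
Definition enorm (R : realType) (n : nat) (x : 'cV[R]_n) : R :=
  Num.sqrt (\sum_(i < n) x i 0 ^+ 2).

Definition spectral_norm (R : realType) (m n : nat) (M : 'M[R]_(m, n)) : R :=
  sup [set enorm (M *m x) | x in [set x : 'cV[R]_n | enorm x <= 1]].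

(* A = U diag(s) V^T with U^T U = I and V orthogonal: the columns of U (V) are
   the left (right) singular vectors belonging to the entries of s. *)
Definition thin_svd (R : realType) (m n : nat) (A : 'M[R]_(m, n))
    (U : 'M[R]_(m, n)) (s : 'rV[R]_n) (V : 'M[R]_n) : Prop :=
  [/\ U^T *m U = 1%:M, V^T *m V = 1%:M,
      forall j, 0 <= s 0 j & A = U *m diag_mx s *m V^T].

(* Since 0^-1 = 0, normalize 0 = 0. Hence, if the Lanczos process below breaks
   down, all later vectors and coefficients vanish. *)
Definition normalize (R : realType) (n : nat) (x : 'cV[R]_n) : 'cV[R]_n :=
  (enorm x)^-1 *: x.

Record lanczos_state (R : realType) (m n : nat) := LanczosState {
  st_beta : R;
  st_p : 'cV[R]_m;
  st_alpha : R;
  st_q : 'cV[R]_n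
}.

(* lanczos_iter A b i holds beta_(i+1), p_(i+1), alpha_(i+1), q_(i+1), with
   beta_1 = |b|: the coefficients are the norms that make the p's and q's unit
   vectors. *)
Fixpoint lanczos_iter (R : realType) (m n : nat) (A : 'M[R]_(m, n))
    (b : 'cV[R]_m) (i : nat) {struct i} : lanczos_state R m n :=
  match i with
  | 0%N =>
      let p := normalize b in
      let w := A^T *m p in
      LanczosState (enorm b) p (enorm w) (normalize w)
  | j.+1 =>
      let: LanczosState _ p alpha q := lanczos_iter A b j in
      let v := A *m q - alpha *: p in
      let beta' := enorm v in
      let p' := normalize v in
      let w := A^T *m p' - beta' *: q in
      LanczosState beta' p' (enorm w) (normalize w)
  end.

(* Indices start at 1; the values at 0 are not used. *)
Definition lanczos_alpha (R : realType) (m n : nat) (A : 'M[R]_(m, n))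
    (b : 'cV[R]_m) (i : nat) : R := st_alpha (lanczos_iter A b i.-1).

Definition lanczos_beta (R : realType) (m n : nat) (A : 'M[R]_(m, n))
    (b : 'cV[R]_m) (i : nat) : R := st_beta (lanczos_iter A b i.-1).

Definition lanczos_p (R : realType) (m n : nat) (A : 'M[R]_(m, n))
    (b : 'cV[R]_m) (i : nat) : 'cV[R]_m := st_p (lanczos_iter A b i.-1).

Definition lanczos_q (R : realType) (m n : nat) (A : 'M[R]_(m, n))
    (b : 'cV[R]_m) (i : nat) : 'cV[R]_n := st_q (lanczos_iter A b i.-1).

Definition lanczos_P (R : realType) (m n : nat) (A : 'M[R]_(m, n))
    (b : 'cV[R]_m) (k : nat) : 'M[R]_(m, k) :=
  \matrix_(i < m, j < k) lanczos_p A b j.+1 i 0.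

Definition lanczos_Q (R : realType) (m n : nat) (A : 'M[R]_(m, n))
    (b : 'cV[R]_m) (k : nat) : 'M[R]_(n, k) :=
  \matrix_(i < n, j < k) lanczos_q A b j.+1 i 0.

Definition lanczos_B (R : realType) (m n : nat) (A : 'M[R]_(m, n))
    (b : 'cV[R]_m) (k : nat) : 'M[R]_(k.+1, k) :=
  \matrix_(i < k.+1, j < k)
    (if i == j :> nat then lanczos_alpha A b j.+1
     else if i == j.+1 :> nat then lanczos_beta A b j.+2
     else 0).

Definition lanczos_gamma (R : realType) (m n : nat) (A : 'M[R]_(m, n))
    (b : 'cV[R]_m) (k : nat) : R :=
  spectral_norm
    (A - lanczos_P A b k.+1 *m lanczos_B A b k *m (lanczos_Q A b k)^T).

(* Main.v *)
Require Import Defs.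
From HB Require Import structures.
From mathcomp Require Import all_boot all_order all_algebra.
From mathcomp Require Import boolp classical_sets reals.

(** Whether or not the process breaks down, the recurrences and the unit-norm
    conditions hold in a form weighted by the coefficients, and they make the
    [q_i] pairwise orthogonal.  Therefore [A - P B Q^T] acts on [q_(k+1)] as [A]
    does, and [p_(k+1) . A q_(k+1) = alpha_(k+1)].  Expanding
    [|A q_(k+1) - alpha_(k+1) p_(k+1)|^2 >= 0] gives
    [alpha_(k+1) <= |A q_(k+1)|]. *)

Set Implicit Arguments.
Unset Strict Implicit.
Unset Printing Implicit Defensive.

Import Order.TTheory GRing.Theory Num.Theory.
Local Open Scope ring_scope.

Definition dot (R : realType) (n : nat) (x y : 'cV[R]_n) : R := (x^T *m y) 0 0.

Section EuclideanSpace.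
Variables (R : realType) (n : nat).
Implicit Types (a : R) (x y z : 'cV[R]_n).

Lemma dotE x y : dot x y = \sum_(i < n) x i 0 * y i 0.
Proof. by rewrite /dot mxE; apply: eq_bigr => i _; rewrite mxE. Qed.

Lemma dotC x y : dot x y = dot y x.
Proof. by rewrite !dotE; apply: eq_bigr => i _; rewrite mulrC. Qed.

Lemma dotDr x y z : dot x (y + z) = dot x y + dot x z.
Proof. by rewrite /dot mulmxDr mxE. Qed.

Lemma dotZr a x y : dot x (a *: y) = a * dot x y.
Proof. by rewrite /dot -scalemxAr mxE. Qed.

Lemma dotDl x y z : dot (x + y) z = dot x z + dot y z.
Proof. by rewrite !(dotC _ z) dotDr. Qed.

Lemma dotZl a x y : dot (a *: x) y = a * dot x y.
Proof. by rewrite !(dotC _ y) dotZr. Qed.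

Lemma dotBr x y z : dot x (y - z) = dot x y - dot x z.
Proof. by rewrite dotDr -scaleN1r dotZr mulN1r. Qed.

Lemma dotBl x y z : dot (x - y) z = dot x z - dot y z.
Proof. by rewrite !(dotC _ z) dotBr. Qed.

Lemma dot_ge0 x : 0 <= dot x x.
Proof. by rewrite dotE sumr_ge0 // => i _; rewrite -expr2 sqr_ge0. Qed.

Lemma enormE x : enorm x = Num.sqrt (dot x x).
Proof. by rewrite /enorm dotE. Qed.

Lemma enorm_ge0 x : 0 <= enorm x.
Proof. exact: sqrtr_ge0. Qed.

Lemma sqr_enorm x : enorm x ^+ 2 = dot x x.
Proof. by rewrite enormE sqr_sqrtr // dot_ge0. Qed.

Lemma enorm0 : enorm (0 : 'cV[R]_n) = 0.
Proof. by rewrite enormE /dot mulmx0 mxE sqrtr0. Qed.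

Lemma enorm_eq0 x : enorm x = 0 -> x = 0.
Proof.
move=> x0; have /eqP := sqr_enorm x.
rewrite x0 expr0n /= eq_sym dotE psumr_eq0 => [/allP h|i _]; last first.
  by rewrite -expr2 sqr_ge0.
apply/colP => i; have := h i (mem_index_enum i).
by rewrite mulf_eq0 orbb mxE => /eqP.
Qed.

Lemma normr_le_enorm x i : `|x i 0| <= enorm x.
Proof.
rewrite -sqrtr_sqr ler_wsqrtr // (bigD1 i) //= lerDl.
by rewrite sumr_ge0 // => j _; rewrite sqr_ge0.
Qed.

Lemma normalize0 : normalize (0 : 'cV[R]_n) = 0.
Proof. exact: scaler0. Qed.

(** No hypothesis [x != 0]: at [0] both sides vanish, so the recurrences below survive a
    breakdown. *)
Lemma enorm_normalize x : enorm x *: normalize x = x.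
Proof.
rewrite /normalize scalerA; have [/enorm_eq0 ->|x0] := eqVneq (enorm x) 0.
  by rewrite !scaler0.
by rewrite divff // scale1r.
Qed.

Lemma dot_normalize x : x != 0 -> dot (normalize x) (normalize x) = 1.
Proof.
move=> x0; rewrite dotZl dotZr -sqr_enorm mulrA -expr2 exprVn.
have e0 : enorm x != 0 by apply: contra_neq x0 => /enorm_eq0.
by rewrite mulVf // expf_neq0.
Qed.

Lemma enorm_normalize_le1 x : enorm (normalize x) <= 1.
Proof.
have [->|x0] := eqVneq x 0; first by rewrite normalize0 enorm0.
by rewrite enormE dot_normalize // sqrtr1.
Qed.

End EuclideanSpace.

Lemma dot_mulmx (R : realType) (m n : nat) (A : 'M[R]_(m, n)) x y :
  dot x (A *m y) = dot (A^T *m x) y.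
Proof. by rewrite /dot trmx_mul trmxK mulmxA. Qed.

Lemma enorm_le_spectral_norm (R : realType) (m n : nat) (M : 'M[R]_(m, n)) x :
  enorm x <= 1 -> enorm (M *m x) <= spectral_norm M.
Proof.
move=> x1; apply: ub_le_sup; last by exists x.
(* The supremum needs an upper bound: entries of a vector in the unit ball are at most 1 in absolute
   value, so each entry of [M *m y] is bounded by an absolute row sum of [M]. *)
exists (Num.sqrt (\sum_i (\sum_j `|M i j|) ^+ 2)) => _ [y y1 <-].
apply: ler_wsqrtr; apply: ler_sum => i _; rewrite -real_normK ?num_real //.
apply: lerXn2r; rewrite ?nnegrE ?sumr_ge0 //.
rewrite mxE (le_trans (ler_norm_sum _ _ _)) //; apply: ler_sum => j _.
by rewrite normrM ler_piMr // (le_trans (normr_le_enorm y j)).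
Qed.

Section LanczosProcess.
Variables (R : realType) (m n : nat) (A : 'M[R]_(m, n)) (b : 'cV[R]_m).

(* Indices are shifted by one: [p i] is the paper's [p_(i+1)]. *)
Local Notation p i := (st_p (lanczos_iter A b i)).
Local Notation q i := (st_q (lanczos_iter A b i)).
Local Notation alpha i := (st_alpha (lanczos_iter A b i)).
Local Notation beta i := (st_beta (lanczos_iter A b i)).

Lemma lanczos_betaS i : beta i.+1 = enorm (A *m q i - alpha i *: p i).
Proof. by rewrite /=; case: (lanczos_iter A b i). Qed.

Lemma lanczos_pS i : p i.+1 = normalize (A *m q i - alpha i *: p i).
Proof. by rewrite /=; case: (lanczos_iter A b i). Qed.

Lemma lanczos_alphaS i : alpha i.+1 = enorm (A^T *m p i.+1 - beta i.+1 *: q i).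
Proof. by rewrite /=; case: (lanczos_iter A b i). Qed.

Lemma lanczos_qS i : q i.+1 = normalize (A^T *m p i.+1 - beta i.+1 *: q i).
Proof. by rewrite /=; case: (lanczos_iter A b i). Qed.

Lemma lanczos_mulq i : A *m q i = beta i.+1 *: p i.+1 + alpha i *: p i.
Proof. by rewrite lanczos_betaS lanczos_pS enorm_normalize subrK. Qed.

Lemma lanczos_mulp0 : A^T *m p 0 = alpha 0 *: q 0.
Proof. by rewrite [RHS]enorm_normalize. Qed.

Lemma lanczos_mulpS i : A^T *m p i.+1 = alpha i.+1 *: q i.+1 + beta i.+1 *: q i.
Proof. by rewrite lanczos_alphaS lanczos_qS enorm_normalize subrK. Qed.

(** Treats the initial step and the later ones uniformly, which spares case splits below. *)
Lemma lanczos_q_normalize i :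
  exists w, alpha i = enorm w /\ q i = normalize w.
Proof.
case: i => [|i]; first by exists (A^T *m p 0).
by rewrite lanczos_alphaS lanczos_qS; exists (A^T *m p i.+1 - beta i.+1 *: q i).
Qed.

(** Either [q i] is a unit vector, or the vector it normalizes is zero and so is its norm
    [alpha i]. *)
Lemma lanczos_alpha_qq i : alpha i * dot (q i) (q i) = alpha i.
Proof.
have [w [-> ->]] := lanczos_q_normalize i.
have [->|w0] := eqVneq w 0; first by rewrite enorm0 mul0r.
by rewrite dot_normalize ?mulr1.
Qed.

Lemma lanczos_beta_pp i : beta i.+1 * dot (p i.+1) (p i.+1) = beta i.+1.
Proof.
rewrite lanczos_betaS lanczos_pS;
  set v := A *m q i - alpha i *: p i.
have [->|v0] := eqVneq v 0; first by rewrite enorm0 mul0r.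
by rewrite dot_normalize ?mulr1.
Qed.

(* If [p i] or [q i] vanishes, then so does the coefficient computed next. *)
Lemma lanczos_alpha_pp i : alpha i * dot (p i) (p i) = alpha i.
Proof.
case: i => [|i].
  rewrite /=; have [->|b0] := eqVneq b 0.
    by rewrite normalize0 mulmx0 enorm0 mul0r.
  by rewrite dot_normalize ?mulr1.
rewrite lanczos_alphaS lanczos_betaS lanczos_pS;
  set v := A *m q i - alpha i *: p i.
have [->|v0] := eqVneq v 0.
  by rewrite normalize0 mulmx0 enorm0 scale0r subr0 enorm0 mul0r.
by rewrite dot_normalize ?mulr1.
Qed.

Lemma lanczos_beta_qq i : beta i.+1 * dot (q i) (q i) = beta i.+1.
Proof.
rewrite lanczos_betaS; have [w [-> ->]] := lanczos_q_normalize i.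
have [->|w0] := eqVneq w 0.
  by rewrite normalize0 mulmx0 enorm0 scale0r subr0 enorm0 mul0r.
by rewrite dot_normalize ?mulr1.
Qed.

(** Induction on [j] for both families at once: [p j.+1] is handled first, and its orthogonality
    then serves for [q j.+1]. *)
Lemma lanczos_orthogonal j i :
  (i < j)%N -> dot (p i) (p j) = 0 /\ dot (q i) (q j) = 0.
Proof.
elim: j i => // j IH.
(* [A^T *m p i] is a combination of [q i] and its predecessor; the latter is orthogonal to [q j] by
   induction, even for [i = j]. *)
have pA i : (i <= j)%N -> dot (p i) (A *m q j) = alpha i * dot (q i) (q j).
  move=> ij; rewrite dot_mulmx; case: i ij => [|i] ij.
    by rewrite lanczos_mulp0 dotZl.
  by rewrite lanczos_mulpS dotDl !dotZl (IH i ij).2 mulr0 addr0.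
have pp i : (i <= j)%N -> dot (p i) (p j.+1) = 0.
  move=> ij; rewrite lanczos_pS dotZr dotBr dotZr pA //.
  (* For [i = j] the two terms are [alpha j] times squared norms, and both equal [alpha j]; for
     [i < j] each vanishes by induction. *)
  move: ij; rewrite leq_eqVlt => /orP[/eqP ->|ij].
    by rewrite lanczos_alpha_qq lanczos_alpha_pp subrr mulr0.
  by have [-> ->] := IH i ij; rewrite !mulr0 subr0 mulr0.
move=> i; rewrite ltnS => ij; split; first exact: pp.
rewrite lanczos_qS dotZr dotBr dotZr dot_mulmx trmxK lanczos_mulq.
rewrite dotDl !dotZl (pp i ij) mulr0 addr0.
(* The same dichotomy with [beta j.+1]; for [i < j], [pp] applies to [i.+1] since [i.+1 <= j]. *)
move: ij; rewrite leq_eqVlt => /orP[/eqP ->|ij].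
  by rewrite lanczos_beta_pp lanczos_beta_qq subrr mulr0.
by rewrite (IH i ij).2 pp // !mulr0 subr0 mulr0.
Qed.

Lemma lanczos_dot_mulq i : dot (p i) (A *m q i) = alpha i.
Proof.
rewrite lanczos_mulq dotDr !dotZr lanczos_alpha_pp.
by rewrite (lanczos_orthogonal (ltnSn i)).1 mulr0 add0r.
Qed.

Lemma lanczos_alpha_ge0 i : 0 <= alpha i.
Proof. by have [w [-> _]] := lanczos_q_normalize i; apply: enorm_ge0. Qed.

Lemma lanczos_alpha_le i : alpha i <= enorm (A *m q i).
Proof.
rewrite -(ler_pXn2r (ltn0Sn 1)) ?nnegrE ?enorm_ge0 ?lanczos_alpha_ge0 //.
have := dot_ge0 (A *m q i - alpha i *: p i).
rewrite dotBr !dotBl !(dotZl, dotZr) (dotC (A *m _)) lanczos_dot_mulq.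
(* One cross term cancels against the square of [alpha i *: p i], leaving the squared norm of
   [A *m q i] minus [alpha i ^+ 2]. *)
by rewrite lanczos_alpha_pp subrr subr0 subr_ge0 -expr2 sqr_enorm.
Qed.

(** With shifted indices the columns are [q 0] up to [q k.-1], so [q k] is the first vector
    outside. *)
Lemma lanczos_Q_orthogonal k : (lanczos_Q A b k)^T *m q k = 0.
Proof.
apply/colP => j; rewrite !mxE.
transitivity (dot (q j) (q k)); last exact: (lanczos_orthogonal (ltn_ord j)).2.
by rewrite dotE; apply: eq_bigr => i _; rewrite !mxE.
Qed.

Lemma lanczos_alpha_le_gamma k : lanczos_alpha A b k.+1 <= lanczos_gamma A b k.
Proof.
(* [lanczos_alpha A b k.+1] is [alpha k] by conversion. *)
apply: (le_trans (lanczos_alpha_le k)).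
(* Subtracts a zero written as the projected matrix applied to [q k], so that [q k] becomes a test
   vector for the spectral norm of the difference. *)
rewrite -[A *m q k](subr0 _) -(mulmx0 _ (lanczos_P A b k.+1 *m lanczos_B A b k)).
rewrite -(lanczos_Q_orthogonal k) mulmxA -mulmxBl.
apply: enorm_le_spectral_norm.
by have [w [_ ->]] := lanczos_q_normalize k; apply: enorm_normalize_le1.
Qed.

End LanczosProcess.

Theorem theorem2p4 (R : realType) (m n : nat)
    (hn : (2 <= n)%N) (hmn : (n <= m)%N)
    (A : 'M[R]_(m, n))
    (U : 'M[R]_(m, n)) (sigma : 'rV[R]_n) (V : 'M[R]_n)
    (hsvd : thin_svd A U sigma V)
    (hsimple : forall i j : 'I_n, (i < j)%N -> sigma 0 j < sigma 0 i)
    (hpos : forall j : 'I_n, 0 < sigma 0 j)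
    (b : 'cV[R]_m)
    (hb : forall j : 'I_n, ((col j U)^T *m b) 0 0 != 0)
    (k : nat) (hk : (1 <= k <= n - 1)%N) :
  lanczos_alpha A b k.+1 <= lanczos_gamma A b k.
Proof. exact: lanczos_alpha_le_gamma. Qed.
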